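(* Let $n\ge 3$, let $K_n(\rho)=\left[\rho^{|j-k|}\right]_{j,k=1}^n$, and let $\lambda=\lambda_c=-n$ be a double eigenvalue of $K_n(\rho_c)$, of type-1 or type-2, with critical values $\rho_c$, $t_c$ and $\mu_c$ as specified in the context ($t_c=\cos\mu_c$). Then the associated eigenvector $\boldsymbol{v}_c=(v_0,\dots,v_{n-1})\in\mathbb{C}^n$ given by $$v_j=\sin\left[\mu_c\left(j-\tfrac{n-1}{2}\right)\right]\ \ (\text{type-1}),\qquad v_j=\cos\left[\mu_c\left(j-\tfrac{n-1}{2}\right)\right]\ \ (\text{type-2}),\qquad j=0,1,\dots,n-1,$$ is isotropic, i.e. $\sum_{j=0}^{n-1}v_j^2=0$.
   Context: $T_k(t)=\cos(k\,\mathrm{Arccos}\,t)$ and $U_k(t)=\frac{\sin[(k+1)\mathrm{Arccos}\,t]}{\sin(\mathrm{Arccos}\,t)}$ for integer and half-integer $k$ (Chebyshev polynomials of the first and second kinds when $k$ is a nonnegative integer). Type-1 (type-2) eigenvalues of $K_n(\rho)$ are those associated with skew-symmetric (symmetric) eigenvectors, i.e. $v_{n-1-j}=-v_j$ (respectively $v_{n-1-j}=v_j$). ''Double eigenvalue'' means an eigenvalue of algebraic multiplicity $2$. Known facts: for $\rho\in\mathbb{C}\setminus\{-1,0,1\}$ every repeated eigenvalue of $K_n(\rho)$ is a double eigenvalue equal to $-n$. It is of type-1 iff $\rho$ equals a value $\rho_c=\frac{U_{(n-1)/2}(t_c)}{U_{(n-3)/2}(t_c)}$, where $t_c\in\mathbb{C}$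 is a zero of the polynomial $\frac{U_{n-1}(t)-n}{t-1}$ ($n=4,6,8,\dots$) or $\frac{U_{n-1}(t)-n}{t^2-1}$ ($n=5,7,9,\dots$). It is of type-2 iff $\rho$ equals a value $\rho_c=\frac{T_{(n+1)/2}(t_c)}{T_{(n-1)/2}(t_c)}$, where $t_c\in\mathbb{C}$ is a zero of the polynomial $\frac{U_{n-1}(t)+n}{t+1}$ ($n=4,6,8,\dots$) or $U_{n-1}(t)+n$ ($n=3,5,7,\dots$). The number $\mu_c\in\mathbb{C}$ is defined via $t_c=\cos\mu_c$. The vector $\boldsymbol{v}_c$ displayed in the claim is known to be an eigenvector of $K_n(\rho_c)$ for the eigenvalue $-n$. *)

(* Defs.v *)
From mathcomp Require Import all_boot all_order all_algebra.
From mathcomp Require Import ring lra.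
From mathcomp Require Import reals sequences exp trigo.
From mathcomp Require Import complex.

Set Implicit Arguments.
Unset Strict Implicit.
Unset Printing Implicit Defensive.

Import Order.TTheory GRing.Theory Num.Theory.
Local Open Scope ring_scope.
Local Open Scope complex_scope.

Section ComplexTrigonometry.
Variable R : realType.
Implicit Types z w : R[i].

Definition expC z : R[i] :=
  (expR (complex.Re z) * cos (complex.Im z)) +i* (expR (complex.Re z) * sin (complex.Im z)).

Definition cosC z : R[i] := (expC ('i * z) + expC (- ('i * z))) / 2.

Definition sinC z : R[i] := (expC ('i * z) - expC (- ('i * z))) / (2 * 'i).

(* Principal argument, in ]-pi, pi] for w != 0. *)
Definition argC w : R :=
  if 0 <= complex.Im w then acos (complex.Re w / Normc.normc w) else - acos (complex.Re w / Normc.normc w).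

Definition logC w : R[i] := ln (Normc.normc w) +i* argC w.

(* Principal inverse cosine; [sqrtc] is the principal square root. *)
Definition arccosC z : R[i] := - 'i * logC (z + 'i * sqrtc (1 - z ^+ 2)).

Lemma expC0 : expC 0 = 1.
Proof. by rewrite /expC /= expR0 cos0 sin0 mulr1 mulr0. Qed.

Lemma expCD z w : expC (z + w) = expC z * expC w.
Proof.
case: z w => [a b] [c d]; rewrite /expC /= expRD cosD sinD; simpc.
by apply/eqP; rewrite eq_complex /=; apply/andP; split; apply/eqP; ring.
Qed.

Lemma expCN z : expC (- z) = (expC z)^-1.
Proof.
have zN : expC z * expC (- z) = 1 by rewrite -expCD subrr expC0.
have z0 : expC z != 0.
  by apply/eqP => z0; move/eqP: zN; rewrite z0 mul0r eq_sym oner_eq0.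
by apply: (mulfI z0); rewrite zN divff.
Qed.

Lemma ii : 'i * 'i = -1 :> R[i].
Proof. by rewrite -expr2 sqr_i. Qed.

Lemma i_neq0 : 'i != 0 :> R[i].
Proof. by rewrite eq_complex /= oner_eq0 andbF. Qed.

Lemma expC_i (x : R) : expC ('i * x%:C) = cos x +i* sin x.
Proof. by rewrite /expC; simpc; rewrite /= expR0 !mul1r. Qed.

Lemma cosC_real (x : R) : cosC x%:C = (cos x)%:C.
Proof.
rewrite /cosC -mulrN -rmorphN !expC_i cosN sinN.
have -> : cos x +i* sin x + cos x +i* - sin x = (cos x)%:C * 2.
  by rewrite mulr_natr mulr2n; simpc.
by rewrite mulfK // pnatr_eq0.
Qed.

Lemma sinC_real (x : R) : sinC x%:C = (sin x)%:C.
Proof.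
rewrite /sinC -mulrN -rmorphN !expC_i cosN sinN.
have -> : cos x +i* sin x - cos x +i* - sin x = (sin x)%:C * (2 * 'i).
  by rewrite mulrA mulr_natr mulr2n; simpc.
by rewrite mulfK // mulf_neq0 ?i_neq0 // pnatr_eq0.
Qed.

Lemma cosCD z w : cosC (z + w) = cosC z * cosC w - sinC z * sinC w.
Proof.
rewrite /cosC /sinC mulrDr opprD !expCD.
have := i_neq0; have := ii.
set j : R[i] := 'i; move: (expC _) (expC _) (expC _) (expC _) => d c b a jj j0.
have -> : (a - c) / (2 * j) * ((b - d) / (2 * j))
        = (a - c) * (b - d) / (4 * (j * j)) by field.
by rewrite jj; field.
Qed.

Lemma sinCD z w : sinC (z + w) = sinC z * cosC w + cosC z * sinC w.
Proof.
rewrite /cosC /sinC mulrDr opprD !expCD.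
have := i_neq0.
by set j : R[i] := 'i; move: (expC _) (expC _) (expC _) (expC _) => d c b a j0; field.
Qed.

Lemma cosCN z : cosC (- z) = cosC z.
Proof. by rewrite /cosC mulrN opprK addrC. Qed.

Lemma sinCN z : sinC (- z) = - sinC z.
Proof. by rewrite /sinC mulrN opprK -[in RHS]mulNr opprB. Qed.

Lemma cosC2Dsin2 z : cosC z ^+ 2 + sinC z ^+ 2 = 1.
Proof.
have := cosCD z (- z); rewrite subrr cosCN sinCN mulrN opprK !expr2 => <-.
by rewrite /cosC mulr0 oppr0 expC0 -mulr2n divff // pnatr_eq0.
Qed.

Lemma logCK w : w != 0 -> expC (logC w) = w.
Proof.
case: w => a b w0; rewrite /expC /logC /=.
set r := Num.sqrt _.
have s0 : 0 <= a ^+ 2 + b ^+ 2 by rewrite addr_ge0 // sqr_ge0.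
have r2 : r ^+ 2 = a ^+ 2 + b ^+ 2 by rewrite sqr_sqrtr.
have r0 : 0 < r.
  rewrite sqrtr_gt0 lt_def s0 andbT paddr_eq0 ?sqr_ge0 // !sqrf_eq0.
  by move: w0; rewrite eq_complex.
have rn0 : r != 0 by rewrite gt_eqF.
have ar : -1 <= a / r <= 1.
  rewrite ler_pdivlMr // ler_pdivrMr // mulN1r mul1r -ler_norml.
  have : `|a| ^+ 2 <= r ^+ 2 by rewrite real_normK ?num_real // r2 lerDl sqr_ge0.
  by rewrite ler_pXn2r // nnegrE ltW.
have cE : cos (acos (a / r)) = a / r by rewrite acosK // in_itv.
have sE : sin (acos (a / r)) = `|b| / r.
  rewrite sin_acos // (_ : 1 - (a / r) ^+ 2 = (b / r) ^+ 2).
    by rewrite sqrtr_sqr normrM normfV (gtr0_norm r0).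
  have -> : (b / r) ^+ 2 = b ^+ 2 / r ^+ 2 by field.
  have -> : (a / r) ^+ 2 = a ^+ 2 / r ^+ 2 by field.
  rewrite r2; field; rewrite -r2; by rewrite expf_neq0.
rewrite lnK ?posrE // /argC /=; apply/eqP; rewrite eq_complex /= -/r.
case: ifPn => b0.
  by rewrite cE sE (ger0_norm b0) ![r * _]mulrC !divfK // !eqxx.
rewrite -ltNge in b0.
by rewrite cosN sinN cE sE (ltr0_norm b0) mulNr opprK ![r * _]mulrC !divfK ?eqxx.
Qed.

Lemma arccosCK z : cosC (arccosC z) = z.
Proof.
rewrite /cosC /arccosC; have := sqr_sqrtc (1 - z ^+ 2).
set s := sqrtc _; move=> s2; set w := z + 'i * s.
have ww : w * (z - 'i * s) = 1.
  have -> : w * (z - 'i * s) = z ^+ 2 - ('i * 'i) * s ^+ 2 by rewrite /w; ring.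
  by rewrite ii s2; ring.
have w0 : w != 0.
  by apply/eqP => w0; move/eqP: ww; rewrite w0 mul0r eq_sym oner_eq0.
rewrite mulNr mulrN mulrA ii mulN1r opprK expCN (logCK w0).
have -> : w^-1 = z - 'i * s by apply: (mulfI w0); rewrite divff.
by rewrite /w addrCA addrK; field.
Qed.

End ComplexTrigonometry.

Section Chebyshev.
Variable R : realType.
Implicit Types (t : R[i]) (p : nat).

(* The index [k] is used at integers and half-integers only.  At
   [t = 1] and [t = -1] the quotient in [chebU] is a division by zero; the
   polynomial [chebU_poly] gives the value there for a natural index. *)
Definition chebT (k t : R[i]) : R[i] := cosC (k * arccosC t).

Definition chebU (k t : R[i]) : R[i] :=
  sinC ((k + 1) * arccosC t) / sinC (arccosC t).

Fixpoint chebU_poly p : {poly R[i]} :=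
  match p with
  | 0%N => 1
  | q.+1 => match q with
            | 0%N => 2 *: 'X
            | r.+1 => 2 *: 'X * chebU_poly q - chebU_poly r
            end
  end.

Lemma chebU_polySS p :
  chebU_poly p.+2 = 2 *: 'X * chebU_poly p.+1 - chebU_poly p.
Proof. by []. Qed.

Lemma horner_chebU_poly p (mu : R[i]) :
  (chebU_poly p).[cosC mu] * sinC mu = sinC (p.+1%:R * mu).
Proof.
have H : (chebU_poly p).[cosC mu] * sinC mu = sinC (p.+1%:R * mu) /\
         (chebU_poly p.+1).[cosC mu] * sinC mu = sinC (p.+2%:R * mu).
  elim: p => [|p [IH1 IH2]].
    split; first by rewrite /= hornerC !mul1r.
    rewrite /= hornerZ hornerX (_ : 2%:R * mu = mu + mu); last by ring.
    by rewrite sinCD; ring.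
  split=> //; rewrite chebU_polySS hornerD hornerN hornerM hornerZ hornerX.
  rewrite mulrBl -[_ * _ * sinC mu]mulrA IH2 IH1.
  have -> : p.+3%:R * mu = p.+2%:R * mu + mu by rewrite mulrSr mulrDl mul1r.
  have -> : p.+1%:R * mu = p.+2%:R * mu - mu.
    by rewrite (mulrSr _ p.+1) mulrDl mul1r addrK.
  rewrite (sinCD _ mu) (sinCD _ (- mu)) cosCN sinCN.
  by move: (sinC _) (cosC _) (sinC mu) (cosC mu) => a b c d; ring.
by case: H.
Qed.

Lemma chebU_polyE p t : t ^+ 2 != 1 -> (chebU_poly p).[t] = chebU p%:R t.
Proof.
move=> t1; rewrite /chebU natr1 -horner_chebU_poly arccosCK mulfK //.
apply: contra t1 => /eqP s0.
by have := cosC2Dsin2 (arccosC t); rewrite arccosCK s0 expr0n addr0 => ->.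
Qed.

Lemma chebU_poly1 p : (chebU_poly p).[1] = p.+1%:R.
Proof.
suff [] : (chebU_poly p).[1] = p.+1%:R /\ (chebU_poly p.+1).[1] = p.+2%:R by [].
elim: p => [|p [IH1 IH2]].
  by rewrite /= hornerC hornerZ hornerX mulr1.
split=> //; rewrite chebU_polySS hornerD hornerN hornerM hornerZ hornerX IH1 IH2.
by rewrite -[p.+3%:R]natr1 -[p.+2%:R]natr1; ring.
Qed.

Lemma chebU_polyN1 p : (chebU_poly p).[-1] = (-1) ^+ p * p.+1%:R.
Proof.
suff [] : (chebU_poly p).[-1] = (-1) ^+ p * p.+1%:R /\
          (chebU_poly p.+1).[-1] = (-1) ^+ p.+1 * p.+2%:R by [].
elim: p => [|p [IH1 IH2]].
  by rewrite /= hornerC hornerZ hornerX expr1 expr0 mul1r; split=> //; ring.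
split=> //; rewrite chebU_polySS hornerD hornerN hornerM hornerZ hornerX IH1 IH2.
by rewrite -[p.+3%:R]natr1 -[p.+2%:R]natr1 !exprS; ring.
Qed.

End Chebyshev.

Section KacMurdockSzego.
Variable R : realType.
Implicit Types (n : nat) (rho lambda t mu : R[i]).

Definition KMS n rho : 'M[R[i]]_n := \matrix_(j, k) rho ^+ `|j - k|%N.

Definition skew_symmetric_vector n (v : 'cV[R[i]]_n) :=
  forall j, v (rev_ord j) 0 = - v j 0.

Definition symmetric_vector n (v : 'cV[R[i]]_n) :=
  forall j, v (rev_ord j) 0 = v j 0.

Definition eigenvector n (A : 'M[R[i]]_n) lambda (v : 'cV[R[i]]_n) :=
  v != 0 /\ A *m v = lambda *: v.

Definition type1_eigenvalue n rho lambda :=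
  exists2 v, eigenvector (KMS n rho) lambda v & skew_symmetric_vector v.

Definition type2_eigenvalue n rho lambda :=
  exists2 v, eigenvector (KMS n rho) lambda v & symmetric_vector v.

Definition double_eigenvalue n (A : 'M[R[i]]_n) lambda :=
  mup lambda (char_poly A) = 2%N.

(* The divisions of polynomials are exact: see [type1_critical_polyK] and
   [type2_critical_polyK]. *)
Definition type1_critical_poly n : {poly R[i]} :=
  (chebU_poly R n.-1 - n%:R%:P) %/ (if odd n then 'X^2 - 1 else 'X - 1).

Definition type2_critical_poly n : {poly R[i]} :=
  if odd n then chebU_poly R n.-1 + n%:R%:P
  else (chebU_poly R n.-1 + n%:R%:P) %/ ('X + 1).

(* If a denominator below vanishes, the quotient is [0] by convention; the
   hypothesis [rho != 0] of the theorem excludes this case. *)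
Definition type1_critical n rho t :=
  [/\ (4 <= n)%N, root (type1_critical_poly n) t &
      rho = chebU ((n%:R - 1) / 2) t / chebU ((n%:R - 3) / 2) t].

Definition type2_critical n rho t :=
  [/\ (3 <= n)%N, root (type2_critical_poly n) t &
      rho = chebT ((n%:R + 1) / 2) t / chebT ((n%:R - 1) / 2) t].

Definition type1_vector n mu : 'cV[R[i]]_n :=
  \col_(j < n) sinC (mu * (j%:R - (n%:R - 1) / 2)).

Definition type2_vector n mu : 'cV[R[i]]_n :=
  \col_(j < n) cosC (mu * (j%:R - (n%:R - 1) / 2)).

Definition isotropic n (v : 'cV[R[i]]_n) := \sum_(j < n) v j 0 ^+ 2 = 0.

Lemma type1_critical_polyK n : (0 < n)%N ->
  type1_critical_poly n * (if odd n then 'X^2 - 1 else 'X - 1)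
  = chebU_poly R n.-1 - n%:R%:P.
Proof.
move=> n0; apply: divpK.
have d1 : 'X - 1 %| chebU_poly R n.-1 - n%:R%:P.
  rewrite -[1]/(1%:P) dvdp_XsubCl rootE hornerD hornerN hornerC chebU_poly1.
  by rewrite prednK // subrr.
case: ifP => n_odd; last exact: d1.
have -> : 'X^2 - 1 = ('X - 1) * ('X + 1) :> {poly R[i]} by rewrite -subr_sqr_1.
have X1 : 'X + 1 = 'X - (-1)%:P :> {poly R[i]} by rewrite polyCN opprK.
rewrite Gauss_dvdp; last first.
  rewrite X1 -[1 in X in coprimep X _]/(1%:P) coprimep_XsubC2 // -opprD oppr_eq0.
  by rewrite (pnatr_eq0 _ 2).
rewrite d1 andTb X1 dvdp_XsubCl rootE hornerD hornerN hornerC chebU_polyN1 prednK //.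
have /negbTE n1 : ~~ odd n.-1 by move: n_odd; rewrite -{1}(prednK n0) /= => ->.
by rewrite -signr_odd n1 expr0 mul1r subrr.
Qed.

Lemma type2_critical_polyK n : (0 < n)%N -> ~~ odd n ->
  type2_critical_poly n * ('X + 1) = chebU_poly R n.-1 + n%:R%:P.
Proof.
case: n => // n _ n_odd; rewrite /type2_critical_poly (negbTE n_odd).
apply: divpK; rewrite (_ : 'X + 1 = 'X - (-1)%:P); last by rewrite polyCN opprK.
rewrite dvdp_XsubCl rootE hornerD hornerC chebU_polyN1 -signr_odd.
by move: n_odd => /=; rewrite negbK => ->; rewrite mulN1r addNr.
Qed.

End KacMurdockSzego.

(* Main.v *)
(** Put U := U_(n-1).  Since sin² x and cos² x are (1 ∓ cos 2x)/2, the sum of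
    the squares of the entries of the eigenvector is (n ∓ S)/2, where
    S = Σ_j cos (2 μ j - (n-1) μ) is a Dirichlet-type sum equal to U (cos μ).
    The critical equation says U (t_c) = n for type-1 and U (t_c) = -n for
    type-2. *)
Require Import Defs.
From mathcomp Require Import all_boot all_order all_algebra.
From mathcomp Require Import ring.
From mathcomp Require Import reals complex.

Set Implicit Arguments.
Unset Strict Implicit.
Unset Printing Implicit Defensive.

Import Order.TTheory GRing.Theory Num.Theory.
Local Open Scope ring_scope.
Local Open Scope complex_scope.

Section SumsOfSquares.
Variable R : realType.
Implicit Types (n p : nat) (a t mu z : R[i]).

Lemma cosC0 : cosC (0 : R[i]) = 1.
Proof. by rewrite /cosC mulr0 oppr0 expC0 -mulr2n divff // pnatr_eq0. Qed.

Lemma cosC_double z : cosC (2 * z) = cosC z ^+ 2 - sinC z ^+ 2.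
Proof. by rewrite mulr_natl mulr2n cosCD !expr2. Qed.

Lemma cosC_sqr z : cosC z ^+ 2 = (1 + cosC (2 * z)) / 2.
Proof. by rewrite cosC_double -[X in (X + _) / _](cosC2Dsin2 z); field. Qed.

Lemma sinC_sqr z : sinC z ^+ 2 = (1 - cosC (2 * z)) / 2.
Proof. by rewrite cosC_double -[X in (X - _) / _](cosC2Dsin2 z); field. Qed.

(** The classical relation U_(p+1) = t U_p + T_(p+1) at t = cos μ. It is proved by the recurrence,
    with no division by sin μ, so it also holds at t = 1 and t = -1. *)
Lemma chebU_polyS_cos p mu :
  (chebU_poly R p.+1).[cosC mu] =
  cosC mu * (chebU_poly R p).[cosC mu] + cosC (p.+1%:R * mu).
Proof.
elim: p => [|p IHp]; first by rewrite /= hornerC hornerZ hornerX mul1r; ring.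
rewrite chebU_polySS hornerD hornerN hornerM hornerZ hornerX.
have -> : p.+2%:R * mu = p.+1%:R * mu + mu by rewrite mulrSr mulrDl mul1r.
(* The factor sin ((p+1) μ) becomes U_p sin μ; the resulting sin² μ is then eliminated in favour of
   cos² μ. *)
rewrite cosCD -horner_chebU_poly.
have -> : cosC (p.+1%:R * mu) =
    (chebU_poly R p.+1).[cosC mu] - cosC mu * (chebU_poly R p).[cosC mu].
  by rewrite IHp addrAC subrr add0r.
set U := (chebU_poly R p).[_].
have -> : U * sinC mu * sinC mu = U * (1 - cosC mu ^+ 2).
  by rewrite -(cosC2Dsin2 mu); ring.
by ring.
Qed.

(** Dirichlet kernel with an arbitrary phase [a]. Induction on [p] replaces the usual telescoping
    after multiplication by sin μ, so sin μ = 0 needs no separate case. *)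
Lemma sum_cosC_arith p a mu :
  \sum_(j < p.+1) cosC (a + 2 * (j%:R * mu)) =
  (chebU_poly R p).[cosC mu] * cosC (a + p%:R * mu).
Proof.
elim: p => [|p IHp].
  by rewrite big_ord1 /= hornerC !mul0r mulr0 addr0 mul1r.
rewrite big_ord_recr /= IHp chebU_polyS_cos.
set b := a + p.+1%:R * mu.
have -> : a + p%:R * mu = b - mu by rewrite /b -[p.+1%:R]natr1; ring.
have -> : a + 2 * (p.+1%:R * mu) = b + p.+1%:R * mu by rewrite /b; ring.
(* After expansion around [b], the terms in sin b cancel because sin ((p+1) μ) = U_p sin μ. *)
by rewrite !cosCD cosCN sinCN -horner_chebU_poly; ring.
Qed.

Lemma sum_cosC_centered n mu : (0 < n)%N ->
  \sum_(j < n) cosC (2 * (mu * (j%:R - (n%:R - 1) / 2))) =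
  (chebU_poly R n.-1).[cosC mu].
Proof.
(* With n = p + 1, the phase -p μ centres the progression and turns the cosine factor into cos 0 =
   1. *)
case: n => // p _; have := sum_cosC_arith p (- (p%:R * mu)) mu.
rewrite addNr cosC0 mulr1 => <-; apply: eq_bigr => j _.
by congr cosC; rewrite -[p.+1%:R]natr1; field.
Qed.

Lemma sum_sqr_type1_vector n mu : (0 < n)%N ->
  \sum_(j < n) type1_vector n mu j 0 ^+ 2 =
  (n%:R - (chebU_poly R n.-1).[cosC mu]) / 2.
Proof.
move=> n_gt0; rewrite -sum_cosC_centered //.
under eq_bigr do rewrite mxE sinC_sqr.
by rewrite -mulr_suml sumrB sumr_const card_ord.
Qed.

Lemma sum_sqr_type2_vector n mu : (0 < n)%N ->
  \sum_(j < n) type2_vector n mu j 0 ^+ 2 =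
  (n%:R + (chebU_poly R n.-1).[cosC mu]) / 2.
Proof.
move=> n_gt0; rewrite -sum_cosC_centered //.
under eq_bigr do rewrite mxE cosC_sqr.
by rewrite -mulr_suml big_split /= sumr_const card_ord.
Qed.

(** Since the division is exact, multiplying back by the divisor shows that a root of the quotient
    is a root of U_(n-1) - n. *)
Lemma root_type1_critical_poly n t : (0 < n)%N ->
  root (type1_critical_poly R n) t -> (chebU_poly R n.-1).[t] = n%:R.
Proof.
move=> n_gt0 /rootP t_root; apply/eqP; rewrite -subr_eq0.
have := congr1 (horner^~ t) (type1_critical_polyK R n_gt0).
by rewrite hornerM t_root mul0r hornerD hornerN hornerC => <-.
Qed.

Lemma root_type2_critical_poly n t : (0 < n)%N ->
  root (type2_critical_poly R n) t -> (chebU_poly R n.-1).[t] = - n%:R.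
Proof.
move=> n_gt0 /rootP t_root; apply/eqP; rewrite -addr_eq0.
have [n_odd|n_even] := boolP (odd n).
  (* For odd n the critical polynomial is U_(n-1) + n itself; only even n involves a quotient. *)
  by move: t_root; rewrite /type2_critical_poly n_odd hornerD hornerC => ->.
have := congr1 (horner^~ t) (type2_critical_polyK R n_gt0 n_even).
by rewrite hornerM t_root mul0r hornerD hornerC => <-.
Qed.

End SumsOfSquares.

Theorem corollary2p6 (R : realType) (n : nat) (rho t mu : R[i])
    (n_ge3 : (3 <= n)%N)
    (rho_neqN1 : rho != -1) (rho_neq0 : rho != 0) (rho_neq1 : rho != 1)
    (dbl : double_eigenvalue (KMS n rho) (- n%:R))
    (tE : t = cosC mu) :
  (type1_eigenvalue n rho (- n%:R) -> type1_critical n rho t ->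
     isotropic (type1_vector n mu)) /\
  (type2_eigenvalue n rho (- n%:R) -> type2_critical n rho t ->
     isotropic (type2_vector n mu)).
Proof.
have n_gt0 : (0 < n)%N by apply: leq_trans n_ge3.
split=> _ [_ t_root _]; rewrite /isotropic.
  rewrite sum_sqr_type1_vector // -tE.
  by rewrite (root_type1_critical_poly n_gt0 t_root) subrr mul0r.
rewrite sum_sqr_type2_vector // -tE.
by rewrite (root_type2_critical_poly n_gt0 t_root) subrr mul0r.
Qed.
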